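(* Let $d\ge 1$ and let $K\subset\mathbb{R}^d$ be a minimal covering body. Then $K$ is a polytope with at least $2d$ facets.
   Context: A convex body in $\mathbb{R}^d$ is a non-empty compact convex set. A convex body $K\subset\mathbb{R}^d$ is called covering if $K+\mathbb{Z}^d=\mathbb{R}^d$. It is called a minimal covering body if it is covering and no convex body $K'\subsetneq K$ is covering. A polytope is the convex hull of finitely many points. *)

(* Defs.v *)
From HB Require Import structures.
From mathcomp Require Import all_boot all_order all_algebra.
From mathcomp Require Import all_classical all_reals all_analysis.
Set Implicit Arguments.
Unset Strict Implicit.
Unset Printing Implicit Defensive.
Import Order.TTheory GRing.Theory Num.Theory.
Import numFieldNormedType.Exports.

Local Open Scope classical_set_scope.
Local Open Scope ring_scope.

Section Defs.
Variables (R : realType) (d : nat).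
Implicit Types (K P F A : set 'rV[R]_d).

Definition convex_body K : Prop :=
  [/\ K !=set0, compact K & @convex_set R 'rV[R]_d K].

Definition int_lattice : set 'rV[R]_d :=
  range (fun z : 'rV[int]_d => map_mx intr z).

Definition covering K : Prop :=
  [set x + z | x in K & z in int_lattice] = [set: 'rV[R]_d].

Definition minimal_covering_body K : Prop :=
  [/\ convex_body K, covering K &
      forall K', convex_body K' -> K' `<` K -> ~ covering K'].

Definition conv_hull A : set 'rV[R]_d :=
  smallest (@convex_set R 'rV[R]_d) A.

Definition polytope P : Prop :=
  exists2 A : set 'rV[R]_d, finite_set A & P = conv_hull A.

(* The empty set is affine in this sense, so that its affine hull is empty. *)
Definition affine_set A : Prop :=
  forall x y (t : R), A x -> A y -> A ((1 - t) *: x + t *: y).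

Definition affine_hull A : set 'rV[R]_d := smallest affine_set A.

(* The affine hull of A is a translate of a k-dimensional linear subspace;
   no k satisfies this when A is empty. *)
Definition has_affine_dim A (k : nat) : Prop :=
  exists (x0 : 'rV[R]_d) (V : {vspace 'rV[R]_d}),
    \dim V = k /\ affine_hull A = [set x0 + v | v in [set` V]].

(* Faces are cut out by valid inequalities <x, u> <= c. The case u = 0 gives
   the improper faces set0 and P, neither of which is a facet. *)
Definition face P F : Prop :=
  exists (u : 'cV[R]_d) (c : R),
    (forall x, P x -> (x *m u) 0 0 <= c) /\
    F = P `&` [set x | (x *m u) 0 0 = c].

Definition facet P F : Prop :=
  face P F /\ exists2 k, has_affine_dim P k.+1 & has_affine_dim F k.

End Defs.

(* Main.v *)
(* A point [x] of [K] is essential if no nonzero lattice translate of it lies in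
   [K]. By minimality, cutting a small cap off [K] at a point [p] farthest from
   some center destroys the covering property, so [p] is a limit of essential
   points. If [p + z] in [K] implies [q + z] in [K] for all lattice vectors [z],
   then pushing essential points near [p] away from [q] cannot lead into another
   translate of [K], as convexity would bring the essential point into it too;
   hence [K] extends beyond [p] on the line [q p], and [p = q] by extremality.
   Only finitely many lattice vectors are involved, so there are finitely many
   farthest points, and [K] is their convex hull.

   Now let [p] be a farthest point. The normals of the facets through [p] span
   the space since [p] is extreme. So do the normals of the other facets: along
   a direction orthogonal to all of them one could again push essential points
   near [p] without entering another translate. Hence there are at least [d]
   facets through [p] and at least [d] facets missing [p]. *)
Require Import Defs.
From mathcomp Require Import all_boot all_order all_algebra.
From mathcomp Require Import all_classical all_reals all_analysis.
From mathcomp Require Import ring lra zify.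
Set Implicit Arguments.
Unset Strict Implicit.
Unset Printing Implicit Defensive.
Import Order.TTheory GRing.Theory Num.Theory.
Import numFieldNormedType.Exports.
Local Open Scope classical_set_scope.
Local Open Scope card_scope.
Local Open Scope ring_scope.

(** * Inner product, norm estimates and continuity *)

Section Dot.
Variables (R : realType) (d : nat).
Implicit Types x y z u w : 'rV[R]_d.

Definition dot x y : R := (x *m y^T) 0 0.

Lemma dotE x y : dot x y = \sum_i x 0 i * y 0 i.
Proof. by rewrite /dot mxE; apply: eq_bigr => i _; rewrite mxE. Qed.

Lemma dotC x y : dot x y = dot y x.
Proof. by rewrite !dotE; apply: eq_bigr => i _; rewrite mulrC. Qed.

Lemma dotDl x y u : dot (x + y) u = dot x u + dot y u.
Proof. by rewrite /dot mulmxDl mxE. Qed.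

Lemma dotNl x u : dot (- x) u = - dot x u.
Proof. by rewrite /dot mulNmx mxE. Qed.

Lemma dotZl a x u : dot (a *: x) u = a * dot x u.
Proof. by rewrite /dot -scalemxAl mxE. Qed.

Lemma dotDr x y u : dot u (x + y) = dot u x + dot u y.
Proof. by rewrite dotC dotDl !(dotC u). Qed.

Lemma dotNr x u : dot u (- x) = - dot u x.
Proof. by rewrite dotC dotNl (dotC u). Qed.

Lemma dotZr a x u : dot u (a *: x) = a * dot u x.
Proof. by rewrite dotC dotZl (dotC u). Qed.

Definition dotL := (dotDl, dotNl, dotZl, dotDr, dotNr, dotZr).

Lemma dot0l u : dot 0 u = 0.
Proof. by rewrite /dot mul0mx mxE. Qed.

Lemma dot_suml (I : Type) (r : seq I) (P : pred I) (F : I -> 'rV[R]_d) u :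
  dot (\sum_(i <- r | P i) F i) u = \sum_(i <- r | P i) dot (F i) u.
Proof. by rewrite /dot mulmx_suml summxE. Qed.

Lemma dot_ge0 x : 0 <= dot x x.
Proof. by rewrite dotE sumr_ge0// => i _; rewrite -expr2 sqr_ge0. Qed.

Lemma dot_eq0 x : (dot x x == 0) = (x == 0).
Proof.
apply/idP/idP => [|/eqP->]; last by rewrite dot0l.
rewrite dotE psumr_eq0; last by move=> i _; rewrite -expr2 sqr_ge0.
move=> /allP x0; apply/eqP/rowP => i; rewrite mxE; apply/eqP.
by rewrite -sqrf_eq0 expr2; exact: (x0 i (mem_index_enum i)).
Qed.

Lemma dot_gt0 x : x != 0 -> 0 < dot x x.
Proof. by move=> x0; rewrite lt_neqAle eq_sym dot_eq0 x0 dot_ge0. Qed.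

Lemma coord_le_norm x i : `|x 0 i| <= `|x|.
Proof.
rewrite [leRHS]/Num.norm /= mx_normrE.
by apply/bigmax_geP; right; exists (0, i).
Qed.

Lemma norm_lt_coord x e : 0 < e -> (forall i, `|x 0 i| < e) -> `|x| < e.
Proof.
move=> e0 xe; rewrite [ltLHS]/Num.norm /= mx_normrE; apply/bigmax_ltP; split => //.
by case=> i j _ /=; rewrite ord1.
Qed.

Lemma norm_lt_dot x e : 0 < e -> dot x x < e ^+ 2 -> `|x| < e.
Proof.
move=> e0 xe; apply: norm_lt_coord => // i.
rewrite -ltr_sqr ?nnegrE ?normr_ge0 ?(ltW e0)// real_normK ?num_real//.
apply: le_lt_trans xe; rewrite dotE (bigD1 i)//= expr2 lerDl.
by apply: sumr_ge0 => j _; rewrite -expr2 sqr_ge0.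
Qed.

Lemma closed_approx (A : set 'rV[R]_d) x : closed A ->
  (forall e, 0 < e -> exists2 y, A y & `|y - x| < e) -> A x.
Proof.
move=> clA Ax; apply: clA => B /nbhs_ballP[e /= e0 eB].
have [y Ay yx] := Ax e e0; exists y; split => //; apply: eB.
by rewrite -ball_normE /ball_ /= distrC.
Qed.

End Dot.

Lemma continuous_sumr (R : realType) (T : topologicalType) n (f : 'I_n -> T -> R) :
  (forall i, continuous (f i)) -> continuous (fun x => \sum_i f i x).
Proof.
elim: n f => [|n IH] f cf x.
  under eq_fun do rewrite big_ord0.
  exact: cst_continuous.
under eq_fun do rewrite big_ord_recl.
by apply: continuousD; [exact: cf|exact: IH].
Qed.

Lemma continuous_mulmx_coord (R : realType) m n (A : 'M[R]_(m, n)) j :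
  continuous (fun c : 'rV[R]_m => (c *m A) 0 j).
Proof.
under eq_fun do rewrite mxE.
apply: continuous_sumr => i x.
by apply: continuousM; [exact: coord_continuous|exact: cst_continuous].
Qed.

Lemma continuous_sqdist (R : realType) m n (A : 'M[R]_(m, n)) y :
  continuous (fun c : 'rV[R]_m => dot (c *m A - y) (c *m A - y)).
Proof.
under eq_fun do rewrite dotE.
apply: continuous_sumr => j.
have cj : continuous (fun c : 'rV[R]_m => (c *m A - y) 0 j).
  rewrite (_ : (fun c => _) = fun c => (c *m A) 0 j - y 0 j); last first.
    by apply/funext => c; rewrite [LHS]mxE [X in _ + X]mxE.
  move=> x; apply: continuousB; last exact: cst_continuous.
  exact: continuous_mulmx_coord.
by move=> x; apply: continuousM; exact: cj.
Qed.

Lemma closed_halfspace (R : realType) d (u : 'rV[R]_d) (a : R) :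
  closed [set x | dot x u <= a].
Proof.
rewrite (_ : mkset _ = (fun x => dot x u) @^-1` [set t | t <= a])//.
apply: preimage_closed => [x _|]; last exact: closed_le.
exact: continuous_mulmx_coord.
Qed.

(** * Convex sets and separation from a finite hull *)

Section Convexity.
Variables (R : realType) (d : nat).
Implicit Types (K A C : set 'rV[R]_d) (x y u w : 'rV[R]_d).

Lemma convex_setP C : @convex_set R 'rV[R]_d C <->
  forall x y t, C x -> C y -> 0 <= t <= 1 -> C (t *: x + (1 - t) *: y).
Proof.
split=> [cC x y t Cx Cy t01|cC x y t /set_mem Cx /set_mem Cy]; last first.
  by apply/mem_set/cC => //; apply/andP; split; [exact: ge0|exact: le1].
have := cC x y (Itv01 (andP t01).1 (andP t01).2) (mem_set Cx) (mem_set Cy).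
by move=> /set_mem.
Qed.

Lemma convex_halfspace u a : @convex_set R 'rV[R]_d [set x | dot x u <= a].
Proof.
apply/convex_setP => x y t /= xa ya /andP[t0 t1]; rewrite !dotL.
nra.
Qed.

Lemma convex_setI A C : @convex_set R 'rV[R]_d A ->
  @convex_set R 'rV[R]_d C -> @convex_set R 'rV[R]_d (A `&` C).
Proof.
move=> /convex_setP cA /convex_setP cC; apply/convex_setP.
by move=> x y t [? ?] [? ?] t01; split; [exact: cA|exact: cC].
Qed.

Lemma convex_comb C n (c : 'I_n -> R) (v : 'I_n -> 'rV[R]_d) :
  @convex_set R 'rV[R]_d C -> (forall i, C (v i)) -> (forall i, 0 <= c i) ->
  \sum_i c i = 1 -> C (\sum_i c i *: v i).
Proof.
move=> /convex_setP cC; elim: n c v => [|n IH] c v Cv c0 c1.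
  by move: c1 (oner_neq0 R); rewrite big_ord0 => <- /eqP.
rewrite big_ord_recl; rewrite big_ord_recl in c1.
have S0 : 0 <= \sum_(i < n) c (lift ord0 i) by rewrite sumr_ge0.
have [E|c01] := eqVneq (c ord0) 1.
  have /eqP : \sum_(i < n) c (lift ord0 i) = 0 by lra.
  rewrite psumr_eq0// => /allP z.
  rewrite big1 ?addr0 ?E ?scale1r// => i _.
  by rewrite (eqP (z i (mem_index_enum i))) scale0r.
have c00 := c0 ord0.
have c0' : 1 - c ord0 != 0 by rewrite subr_eq0 eq_sym.
have -> : \sum_(i < n) c (lift ord0 i) *: v (lift ord0 i) = (1 - c ord0) *:
    \sum_(i < n) (c (lift ord0 i) / (1 - c ord0)) *: v (lift ord0 i).
  rewrite scaler_sumr; apply: eq_bigr => i _.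
  by rewrite scalerA mulrC divfK.
apply: cC => //; last lra.
apply: IH => // [i|]; first by rewrite divr_ge0//; lra.
by rewrite -mulr_suml (_ : \sum_(i < n) _ = 1 - c ord0) ?divff//; lra.
Qed.

Lemma sub_conv_hull A : A `<=` conv_hull A.
Proof. exact: sub_gen_smallest. Qed.

Lemma convex_conv_hull A : @convex_set R 'rV[R]_d (conv_hull A).
Proof.
apply/convex_setP => x y t Ax Ay t01 C [cC AC].
by move/convex_setP : (cC); apply => //; [exact: Ax|exact: Ay].
Qed.

Lemma conv_hull_sub A C : @convex_set R 'rV[R]_d C -> A `<=` C ->
  conv_hull A `<=` C.
Proof. by move=> cC AC; exact: smallest_sub. Qed.

End Convexity.

(* The closest point to [y] is found by minimizing over the compact simplex of
   barycentric coordinates, which avoids proving that the hull is closed. *)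
Lemma conv_hull_separation (R : realType) (d : nat) (s : seq 'rV[R]_d)
    (y : 'rV[R]_d) :
  ~ conv_hull [set` s] y ->
  exists (w : 'rV[R]_d) (a : R),
    (forall v, v \in s -> dot v w <= a) /\ a < dot y w.
Proof.
have [->|s0] := eqVneq s [::].
  (* With no points to bound, the zero functional and any negative bound separate. *)
  by move=> _; exists 0, (-1); split=> //; rewrite dotC dot0l; lra.
move=> ys; set n := size s.
have n0 : (0 < n)%N by rewrite lt0n size_eq0.
pose A : 'M[R]_(n, d) := \matrix_(i, j) (nth 0 s i) 0 j.
pose S := [set c : 'rV[R]_n | (forall i, 0 <= c 0 i) /\ \sum_i c 0 i = 1].
have rA (c : 'rV[R]_n) : c *m A = \sum_i c 0 i *: nth 0 s i.
  rewrite mulmx_sum_row; apply: eq_bigr => i _; congr (_ *: _).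
  by apply/rowP => j; rewrite !mxE.
have hS c : S c -> conv_hull [set` s] (c *m A).
  move=> [c0 c1]; rewrite rA; apply: convex_comb => //.
    exact: convex_conv_hull.
  by move=> i; apply: sub_conv_hull => /=; apply: mem_nth.
have eS k : S (delta_mx 0 k).
  split=> [i|]; first by rewrite mxE eqxx /=; case: eqP.
  rewrite (bigD1 k)//= big1 ?addr0 ?mxE ?eqxx// => i /negbTE ik.
  by rewrite mxE ik andbF.
have S_convex c e t : S c -> S e -> 0 <= t <= 1 -> S (c + t *: (e - c)).
  move=> [c0 c1] [e0 e1] /andP[t0 t1]; split=> [i|].
    by have := c0 i; have := e0 i; rewrite !mxE; nra.
  under eq_bigr do rewrite !mxE.
  by rewrite big_split /= -mulr_sumr sumrB c1 e1; lra.
have cS : compact S.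
  apply: bounded_closed_compact.
    exists 1; split; first exact: num_real.
    move=> M M1 c [c0 c1]; apply/ltW/norm_lt_coord; first lra.
    move=> i; apply: le_lt_trans M1; rewrite ger0_norm// -c1 (bigD1 i)//= lerDl.
    by apply: sumr_ge0.
  rewrite (_ : S = (\bigcap_i [set c : 'rV[R]_n | 0 <= c 0 i]) `&`
     [set c : 'rV[R]_n | \sum_i c 0 i = 1]); last first.
    by apply/seteqP; split=> c [c0 c1]; split=> // i; [move=> _|]; exact: c0.
  apply: closedI.
    apply: closed_bigI => i _.
    apply: (@preimage_closed _ _ (fun c : 'rV[R]_n => c 0 i) [set t | 0 <= t]).
      by move=> c _; exact: coord_continuous.
    exact: closed_ge.
  apply: (@preimage_closed _ _ (fun c : 'rV[R]_n => \sum_i c 0 i) [set 1]).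
    by move=> c _; apply: continuous_sumr => i; exact: coord_continuous.
  exact: closed_eq.
have [|c /set_mem Sc cmin] := EVT_min_rV _ cS
    (@continuous_subspaceT _ _ _ _ (@continuous_sqdist R n d A y)).
  by exists (delta_mx 0 (Ordinal n0)); exact: eS.
set q := c *m A.
have qy : y - q != 0.
  rewrite subr_eq0; apply/eqP => yq; apply: ys; rewrite yq; exact: hS.
exists (y - q), (dot q (y - q)); split; last first.
  by rewrite -subr_gt0 -dotNl -dotDl dot_gt0.
move=> v vs.
pose k := Ordinal (etrans (index_mem v s) vs).
have vk : delta_mx 0 k *m A = v.
  by rewrite -rowE; apply/rowP => j; rewrite !mxE /= nth_index.
rewrite leNgt; apply/negP => lt_qv.
pose b := dot v (y - q) - dot q (y - q).
have b0 : 0 < b by rewrite subr_gt0.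
pose D := dot (v - q) (v - q).
have D0 : 0 <= D by exact: dot_ge0.
(* Moving from [q] towards [v] by [t] changes the squared distance to [y] by [t * (t * D - 2 * b)].
   This [t] gives [t * D < b], so the distance drops, against the choice of [q]. *)
pose t := b / (b + D + 1).
have t01 : 0 <= t <= 1.
  by rewrite divr_ge0 ?ler_pdivrMr ?mul1r/=; lra.
have t0 : 0 < t by rewrite divr_gt0//; lra.
have := cmin _ (mem_set (S_convex _ _ t Sc (eS k) t01)).
rewrite mulmxDl -scalemxAl mulmxBl vk -/q.
have tD : t * D < b.
  rewrite /t mulrAC ltr_pdivrMr; last lra.
  by rewrite ltr_pM2l//; lra.
have bE : b = dot (v - q) (y - q) by rewrite /b dotDl dotNl.
have -> : q + t *: (v - q) - y = t *: (v - q) - (y - q).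
  by apply/rowP => j; rewrite !mxE; ring.
have -> : q - y = - (y - q) by rewrite opprB.
rewrite dotDl !dotDr !dotNr !dotNl !dotZl !dotZr (dotC (y - q) (v - q)) -bE -/D.
by move: (dot _ _) => X; nra.
Qed.

(** Each [P t] holds at every sufficiently small [e'], so the least of the finitely many thresholds
    serves all [t]; the seed 1 covers an empty [T]. *)
Lemma fin_uniform_eps (R : realType) (T : finType) (P : T -> R -> Prop) :
  (forall t, exists2 e, 0 < e & forall e', 0 < e' <= e -> P t e') ->
  exists2 e, 0 < e & forall t, P t e.
Proof.
move=> eP.
have /choice[f fP] : forall t, exists e : R,
    0 < e /\ forall e', 0 < e' <= e -> P t e'.
  by move=> t; have [e e0 he] := eP t; exists e.
have m0 : 0 < \big[Order.min/1]_t f t.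
  by apply/bigmin_gtP; split=> // t _; exact: (fP t).1.
exists (\big[Order.min/1]_t f t) => // t.
by apply: (fP t).2; rewrite m0 bigmin_le_cond.
Qed.

(** * Lattice translates, essential points and farthest points *)

Section Lattice.
Variables (R : realType) (d : nat).
Implicit Types (K : set 'rV[R]_d) (x y p v w c : 'rV[R]_d) (z : 'rV[int]_d).

Definition lat z : 'rV[R]_d := map_mx intr z.

Lemma latN z : lat (- z) = - lat z.
Proof. by apply/rowP => i; rewrite !mxE rmorphN. Qed.

Lemma lat_small z : `|lat z| < 1 -> z = 0.
Proof.
move=> z1; apply/rowP => i; rewrite mxE.
have := le_lt_trans (coord_le_norm (lat z) i) z1.
rewrite mxE -intr_norm -[1]/(1%:~R) ltr_int; lia.
Qed.

Lemma lat_box (M : R) : exists (T : finType) (g : T -> 'rV[int]_d),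
  forall z, `|lat z| <= M -> exists t, g t = z.
Proof.
pose N := Num.bound `|M|.
exists {ffun 'I_d -> 'I_(N + N).+1}.
exists (fun f : {ffun 'I_d -> 'I_(N + N).+1} =>
  \row_i ((f i)%:Z - N%:Z)) => z zM.
have zN i : (`|z 0 i| < N%:Z)%R.
  rewrite -(ltr_int R) intr_norm.
  have := coord_le_norm (lat z) i; rewrite mxE => /le_lt_trans; apply.
  apply: le_lt_trans zM _; apply: le_lt_trans (ler_norm _) _.
  exact/archi_boundP/normr_ge0.
exists [ffun i => inord (absz (z 0 i + N%:Z)%R)].
by apply/rowP => i; rewrite mxE ffunE inordK; have := zN i; lia.
Qed.

Lemma coveringP K : covering K <-> forall y, exists z, K (y + lat z).
Proof.
split=> [cK y|cK].
  have : [set: 'rV[R]_d] y by [].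
  rewrite -cK => -[x Kx [_ [z _ <-] <-]].
  by exists (- z); rewrite latN addrK.
apply/seteqP; split=> // y _; have [z Kz] := cK y.
exists (y + lat z) => //; exists (lat (- z)); first by exists (- z).
by rewrite latN addrK.
Qed.

Lemma compact_norm_bound K : compact K ->
  exists M : R, forall x, K x -> `|x| <= M.
Proof.
move=> /compact_bounded/ex_strict_bound_gt0[M _ KM].
by exists M => x Kx; exact/ltW/KM.
Qed.

(** For [y] within 1 of [p], boundedness of [K] leaves finitely many candidates [z]. Each with
    [p + lat z] outside the closed set [K] is excluded on a neighborhood of [p]. *)
Lemma translates_near K p : compact K ->
  exists2 e, 0 < e &
    forall y z, `|y - p| < e -> K (y + lat z) -> K (p + lat z).
Proof.
move=> cK.
have clK : closed K by exact: (compact_closed (@norm_hausdorff _ _)).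
have [M KM] := compact_norm_bound cK.
have [T [g gP]] := lat_box (M + 1 + `|p|).
have [|e e0 eP] := @fin_uniform_eps R T (fun t e =>
    forall y, `|y - p| < e -> K (y + lat (g t)) -> K (p + lat (g t))).
  move=> t; have [Kp|nKp] := pselect (K (p + lat (g t))); first by exists 1.
  have /existsNP[e] : ~ forall e, 0 < e ->
      exists2 y, K y & `|y - (p + lat (g t))| < e.
    by move=> /(closed_approx clK).
  move=> /not_implyP[e0 eK]; exists e => // e' /andP[e'0 e'e] y yp Ky; case: eK.
  exists (y + lat (g t)) => //; rewrite opprD addrACA subrr addr0.
  exact: lt_le_trans e'e.
exists (Num.min e 1); first by rewrite lt_min e0 ltr01.
move=> y z; rewrite lt_min => /andP[ye y1] Kyz.
have [|t tz] := gP z; last by rewrite -tz in Kyz *; exact: eP Kyz.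
have -> : lat z = (y + lat z) - (y - p) - p.
  by apply/rowP => i; rewrite !mxE; ring.
rewrite (le_trans (ler_normB _ _))// lerD2r (le_trans (ler_normB _ _))//.
by rewrite lerD ?KM// ltW.
Qed.

Definition essential K x := K x /\ forall z, K (x + lat z) -> z = 0.

Definition essential_limit K p :=
  forall e, 0 < e -> exists2 x, essential K x & `|x - p| < e.

Definition extreme_point K p := forall w, K (p + w) -> K (p - w) -> w = 0.

(** The pushed point [x + a *: (x - p) + v] tends to [p + v] as the essential point [x] tends to
    [p]. Some translate of it lies in [K]; near [p] only those with [p + lat z] in [K] compete, and
    the hypothesis rules out [z != 0]. So the pushed point itself is in [K], and closedness gives
    the limit. *)
Lemma essential_push K p : compact K -> covering K -> essential_limit K p ->
  exists2 e, 0 < e & forall a v, 0 <= a -> `|v| < e ->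
    (forall x z, essential K x -> z != 0 -> K (p + lat z) ->
       ~ K (x + a *: (x - p) + v + lat z)) ->
    K (p + v).
Proof.
move=> cK /coveringP covK Up.
have clK : closed K by exact: (compact_closed (@norm_hausdorff _ _)).
have [e e0 eP] := translates_near p cK.
exists e => // a v a0 ve nK; apply: (closed_approx clK) => r r0.
have a1 : 0 < 1 + a by rewrite ltr_wpDr.
(* The push multiplies the distance from [x] to [p] by [1 + a], hence the division. *)
have [|x Ux xp] := Up (Num.min r (e - `|v|) / (1 + a)).
  by rewrite divr_gt0// lt_min r0 subr_gt0.
set y := x + a *: (x - p) + v.
have yE : y - (p + v) = (1 + a) *: (x - p).
  by apply/rowP => i; rewrite !mxE; ring.
have : `|y - (p + v)| < Num.min r (e - `|v|).
  by rewrite yE normrZ gtr0_norm// mulrC -ltr_pdivlMr.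
rewrite lt_min => /andP[yr ye].
have yp : `|y - p| < e.
  rewrite (_ : y - p = y - (p + v) + v); last first.
    by apply/rowP => i; rewrite !mxE; ring.
  by rewrite (le_lt_trans (ler_normD _ _))// -ltrBrDr.
exists y => //; have [z Kyz] := covK y.
have Kpz := eP _ _ yp Kyz.
have [z0|z0] := eqVneq z 0; last by case: (nK x z Ux z0 Kpz).
move: Kyz; rewrite z0 (_ : lat 0 = 0) ?addr0//.
by apply/rowP => i; rewrite !mxE.
Qed.

Lemma translates_inj K p q : compact K -> @convex_set R 'rV[R]_d K ->
  covering K -> K p -> K q -> essential_limit K p -> extreme_point K p ->
  (forall z, K (p + lat z) -> K (q + lat z)) -> p = q.
Proof.
move=> cK /convex_setP cvK covK Kp Kq Up xp pq.
have [e e0 eP] := essential_push cK covK Up.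
(* Small enough that [a *: (p - q)] has norm below [e], and at most 1 so that [p - a *: (p - q)]
   stays on the segment from [q] to [p]. *)
pose a := e / (e + `|p - q| + 1).
have D0 : 0 < e + `|p - q| + 1 by rewrite ltr_wpDl// addr_ge0// ltW.
have a0 : 0 < a by rewrite divr_gt0.
have a1 : a <= 1.
  by rewrite ler_pdivrMr// mul1r -addrA lerDl addr_ge0.
suff Kv : K (p + a *: (p - q)).
  have /xp/(_ _)/eqP : K (p + a *: (p - q)) by [].
  rewrite scaler_eq0 gt_eqF//= subr_eq0 => h; apply/eqP/h.
  rewrite (_ : _ - _ = a *: q + (1 - a) *: p).
    by apply: cvK => //; rewrite ltW.
  by apply/rowP => i; rewrite !mxE; ring.
apply: (eP a); first exact: ltW.
  rewrite normrZ gtr0_norm// mulrAC ltr_pdivrMr// ltr_pM2l//.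
  by rewrite -addrA ltr_pwDl// lerDl.
move=> x z [Kx Ux] z0 Kpz Kyz.
have a1' : 1 + a != 0 by rewrite gt_eqF// addr_gt0.
have /Ux/eqP : K (x + lat z); last by rewrite (negbTE z0).
(* The pushed point is [x + a *: (x - q)], so [x] lies between it and [q], with weight [(1 + a)^-1]
   on the pushed point. *)
rewrite (_ : x + lat z = (1 + a)^-1 *: (x + a *: (x - p) + a *: (p - q) + lat z)
   + (1 - (1 + a)^-1) *: (q + lat z)).
  apply: cvK => //; first exact: pq.
  by rewrite invr_ge0 invf_le1 ?addr_gt0// lerDl !ltW// addr_gt0.
by apply/rowP => i; rewrite !mxE; field.
Qed.

Definition farthest K c p :=
  K p /\ forall x, K x -> dot (x - c) (x - c) <= dot (p - c) (p - c).

Lemma ex_farthest K c : K !=set0 -> compact K -> exists p, farthest K c p.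
Proof.
move=> K0 cK.
have [p /set_mem Kp pmax] := EVT_max_rV K0 cK
    (@continuous_subspaceT _ _ _ _ (@continuous_sqdist R d d 1%:M c)).
exists p; split=> // x /mem_set/pmax.
by rewrite !mulmx1.
Qed.

(** By the parallelogram law, the squared distances of [p + w] and [p - w] from [c] average to that
    of [p] plus [dot w w]. *)
Lemma farthest_extreme K c p : farthest K c p -> extreme_point K p.
Proof.
move=> [Kp pmax] w /pmax + /pmax.
rewrite (_ : p + w - c = (p - c) + w); last by rewrite addrAC.
rewrite (_ : p - w - c = (p - c) - w); last by rewrite addrAC.
rewrite !dotL => h1 h2; apply/eqP; rewrite -dot_eq0; apply/eqP/le_anti.
by rewrite dot_ge0 andbT; lra.
Qed.

(* Cutting off a small cap around [p] must destroy the covering property, and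
   a point uncovered by the rest of [K] has all its translates in the cap. *)
Lemma farthest_essential K c p :
  minimal_covering_body K -> farthest K c p -> essential_limit K p.
Proof.
move=> [[_ cK cvK] covK Kmin] [Kp pmax] e e0.
(* With radius at most 1/2, two points of the cap differ by less than 1 in norm, so a lattice vector
   joining them vanishes. *)
pose f := Num.min e (1 / 2).
have f0 : 0 < f by rewrite lt_min e0 divr_gt0.
have fe : f <= e by rewrite ge_min lexx.
have f1 : f <= 1 / 2 by rewrite ge_min lexx orbT.
(* As [p] is farthest from [c], each [x] in [K] has squared distance to [p] at most
   [2 * (dot p (p - c) - dot x (p - c))], which is below [f ^+ 2] on the cap. *)
pose a := dot p (p - c) - f ^+ 2 / 2.
pose K' := K `&` [set x | dot x (p - c) <= a].
have cap x : K x -> ~ K' x -> `|x - p| < f.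
  move=> Kx nK'; apply: norm_lt_dot => //.
  have {nK'} : a < dot x (p - c).
    by rewrite ltNge; apply/negP => h; apply: nK'.
  have := pmax x Kx; rewrite /a.
  rewrite (_ : x - p = (x - c) - (p - c)); last by rewrite opprB addrA subrK.
  have -> : dot x (p - c) = dot (x - c) (p - c) + dot c (p - c).
    by rewrite -dotDl subrK.
  have -> : dot p (p - c) = dot (p - c) (p - c) + dot c (p - c).
    by rewrite -dotDl subrK.
  move: (x - c) (p - c) => u v; rewrite !dotL (dotC v u); lra.
have nK'p : ~ K' p.
  move=> [_ /=]; rewrite /a; have : 0 < f ^+ 2 by rewrite exprn_gt0.
  lra.
have ncK' : ~ covering K'.
  (* Minimality speaks only of convex bodies, so an empty remainder is treated apart. *)
  have [K'0|K'0] := pselect (K' !=set0); last first.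
    by move=> /coveringP/(_ 0)[z K'z]; apply: K'0; exists (0 + lat z).
  apply: Kmin; last by split=> [x []//|KK']; exact/nK'p/KK'.
  split=> //; last exact/convex_setI/convex_halfspace.
  exact/(compact_closedI cK)/closed_halfspace.
have /existsNP[y /forallNP yK'] : ~ forall y, exists z, K' (y + lat z).
  by move=> /coveringP.
have /coveringP/(_ y)[z0 Kyz0] := covK.
have yz0p := cap _ Kyz0 (yK' z0).
exists (y + lat z0); last exact: lt_le_trans fe.
split=> // z Kz; apply: lat_small.
have nK'z : ~ K' (y + lat z0 + lat z).
  by rewrite -addrA -[lat z0 + _](@map_mxD) //; exact: yK'.
have zp := cap _ Kz nK'z.
rewrite (_ : lat z = (y + lat z0 + lat z - p) - (y + lat z0 - p)).
  by rewrite (le_lt_trans (ler_normB _ _))//; lra.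
by apply/rowP => i; rewrite !mxE; ring.
Qed.

Definition farthest_points K := [set p | exists c, farthest K c p].

Lemma finite_farthest_points K :
  minimal_covering_body K -> finite_set (farthest_points K).
Proof.
move=> mK; have [[_ cK cvK] covK _] := mK.
have [M KM] := compact_norm_bound cK.
(* A lattice vector joining two points of [K] has norm at most [M + M], so the set [S p] records
   every [z] with [p + lat z] in [K]. *)
have [T [g gP]] := lat_box (M + M).
pose S p : {set T} := finset (fun t => `[< K (p + lat (g t)) >]).
suff Sinj : {in farthest_points K &, injective S}.
  have /card_eqPle[_ SK] := inj_card_eq Sinj.
  exact: card_le_finite SK finite_finset.
move=> p q /set_mem[c pc] /set_mem[c' qc'] Spq.
apply: (translates_inj cK cvK covK pc.1 qc'.1).
- exact: farthest_essential mK pc.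
- exact: farthest_extreme pc.
move=> z Kpz.
have [|t tz] := gP z.
  rewrite (_ : lat z = (p + lat z) - p); last by rewrite addrC addKr.
  by rewrite (le_trans (ler_normB _ _))// lerD// KM//; exact: pc.1.
have : t \in S p by rewrite inE tz; apply/asboolP.
by rewrite Spq inE tz => /asboolP.
Qed.

End Lattice.

Lemma uncountable_unit_itv (R : realType) : ~ countable [set` `[0 : R, 1]].
Proof.
move=> /countable_lebesgue_measure0.
rewrite lebesgue_measure_itv /= lte_fin ltr01 sube0 => /eqP.
by rewrite eqe oner_eq0.
Qed.

Lemma seq_argmin (R : realType) (T : eqType) (f : T -> R) (x : T) (s : seq T) :
  x \in s -> exists2 y, y \in s & forall z, z \in s -> f y <= f z.
Proof.
elim: s x => // a s IH x _.
have [->|s0] := eqVneq s [::].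
  by exists a; rewrite ?mem_head// => z; rewrite inE => /eqP->.
have [b bs] : exists b, b \in s by case: s s0 {IH} => // b s _; exists b; rewrite mem_head.
have [y ys ymin] := IH b bs.
have [ay|ya] := leP (f a) (f y).
  exists a; first exact: mem_head.
  by move=> z; rewrite inE => /predU1P[->//|/ymin]; exact: le_trans.
exists y; first by rewrite inE ys orbT.
by move=> z; rewrite inE => /predU1P[->|/ymin//]; exact: ltW.
Qed.

(** Strict decrease of the number of non-tight points, the induction measure in
    [ex_facet_normal]. *)
Lemma count_lt (T : eqType) (P Q : pred T) (s : seq T) (x : T) :
  {in s, subpred P Q} -> x \in s -> Q x -> ~~ P x ->
  (count P s < count Q s)%N.
Proof.
move=> PQ xs Qx nPx.
rewrite -(size_filter Q) -(count_predC P [seq y <- s | Q y]) count_filter.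
rewrite (@eq_in_count _ _ P); last first.
  by move=> y ys /=; apply: andb_idr => /(PQ y ys).
rewrite -[ltnLHS]addn0 ltn_add2l -has_count; apply/hasP.
by exists x => //; rewrite mem_filter Qx xs.
Qed.

(** * Interior centers, facet normals and their spanning properties *)

Section Polytope.
Variables (R : realType) (d : nat).
Implicit Types (K A : set 'rV[R]_d) (x y p u v w o : 'rV[R]_d).
Implicit Types s : seq 'rV[R]_d.

Lemma conv_hull_le s w a x : (forall v, v \in s -> dot v w <= a) ->
  conv_hull [set` s] x -> dot x w <= a.
Proof.
by move=> sa; apply: (conv_hull_sub (@convex_halfspace _ _ w a)) => v /sa.
Qed.

(** Turns each of the two spanning properties of normals into a lower bound on their number. *)
Lemma orthogonal_size s :
  (forall w, (forall u, u \in s -> dot w u = 0) -> w = 0) -> (d <= size s)%N.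
Proof.
move=> s0; pose A : 'M[R]_(d, size s) := \matrix_(i, j) (nth 0 s j) 0 i.
suff /eqP rA : row_free A by have := rank_leq_col A; rewrite rA.
rewrite -kermx_eq0; apply/eqP/row_matrixP => i; rewrite row0; apply: s0 => u us.
have : (row i (kermx A) *m A) 0 (Ordinal (etrans (index_mem u s) us)) = 0.
  by rewrite -row_mul mulmx_ker !mxE.
rewrite mxE dotE => {2}<-; apply: eq_bigr => j _.
by rewrite [A _ _]mxE /= nth_index.
Qed.

(** If [K] lay in a hyperplane, each [r *: w] would reach it by a lattice vector that determines
    [r]; then the unit interval would be countable. *)
Lemma covering_not_in_hyperplane K w a :
  covering K -> w != 0 -> exists2 x, K x & dot x w != a.
Proof.
move=> /coveringP covK w0; apply: contrapT => nK.
have Kw x : K x -> dot x w = a.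
  by move=> Kx; apply/eqP/negP => /negP xa; apply: nK; exists x.
apply: (@uncountable_unit_itv R).
apply: (@sub_countable _ _ _ (range (fun z => (a - dot (lat R z) w) / dot w w))).
  apply: subset_card_le => r _; have [z /Kw] := covK (r *: w).
  rewrite dotDl dotZl => <-; exists z => //.
  by rewrite addrK mulfK// dot_eq0.
apply: sub_countable (card_image_le _ _) _; exact: countableP.
Qed.

(* I.e., [o] is an interior point of [conv_hull [set` s]]. *)
Definition interior_center s o :=
  forall w, w != 0 -> exists2 v, v \in s & 0 < dot (v - o) w.

(** The barycenter of [s] works: if [dot (v - o) w] is never positive, these values sum to zero and
    hence all vanish, which puts the hull in a hyperplane. *)
Lemma ex_interior_center s : conv_hull [set` s] !=set0 ->
  covering (conv_hull [set` s]) -> exists o, interior_center s o.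
Proof.
move=> s0 covs; set n := size s.
have n0 : n%:R != 0 :> R.
  rewrite pnatr_eq0 size_eq0; apply/eqP => s_nil.
  have [x sx] := s0.
  have : dot x 0 <= -1 by apply: conv_hull_le sx => v; rewrite s_nil.
  by rewrite dotC dot0l; lra.
pose o := n%:R^-1 *: \sum_(i < n) nth 0 s i; exists o => w w0.
apply: contrapT => nv.
have le0 v : v \in s -> dot (v - o) w <= 0.
  by move=> vs; rewrite leNgt; apply/negP => h; apply: nv; exists v.
have S0 : \sum_(i < n) - dot (nth 0 s i - o) w = 0.
  rewrite sumrN -dot_suml big_split /= sumr_const card_ord -scaler_nat.
  by rewrite scalerN scalerA divff// scale1r subrr dot0l oppr0.
have eq_o v : v \in s -> dot v w = dot o w.
  move=> vs; pose i := Ordinal (etrans (index_mem v s) vs).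
  move/eqP: S0; rewrite psumr_eq0 => [/allP/(_ i (mem_index_enum i))|j _].
    by rewrite /= nth_index// oppr_eq0 dotDl dotNl subr_eq0 => /eqP.
  by rewrite oppr_ge0 le0// mem_nth.
have [x xs /eqP] := covering_not_in_hyperplane (dot o w) covs w0; apply.
apply/le_anti/andP; split; first by apply: conv_hull_le xs => v /eq_o ->.
rewrite -lerN2 -!dotNr; apply: conv_hull_le xs => v vs.
by rewrite !dotNr eq_o.
Qed.

(* I.e., [u] is a vertex of the polar body of [s - o]. *)
Definition facet_normal s o u :=
  (forall v, v \in s -> dot (v - o) u <= 1) /\
  (forall w, (forall v, v \in s -> dot (v - o) u = 1 -> dot (v - o) w = 0) ->
     w = 0).

(* As long as the tight points do not span, move [u] along a direction
   orthogonal to them until a new point becomes tight. *)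
Lemma ex_facet_normal s o y u : interior_center s o ->
  (forall v, v \in s -> dot (v - o) u <= 1) ->
  exists2 u', facet_normal s o u' & dot (y - o) u <= dot (y - o) u'.
Proof.
move=> cs; have [n le_n] := ubnP (count (fun v => dot (v - o) u != 1) s).
elim: n u le_n => // n IH u le_n u1.
have [fu|nfu] := pselect (facet_normal s o u); first by exists u.
(* The sign of [w] is chosen so that moving along it does not decrease the value at [y]. *)
have [w [w0 wT yw]] : exists w, [/\ w != 0,
    forall v, v \in s -> dot (v - o) u = 1 -> dot (v - o) w = 0 &
    0 <= dot (y - o) w].
  have /existsNP[w /not_implyP[wT /eqP w0]] : ~ forall w, (forall v, v \in s ->
      dot (v - o) u = 1 -> dot (v - o) w = 0) -> w = 0.
    by move=> h; apply: nfu.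
  have [yw|yw] := leP 0 (dot (y - o) w); first by exists w.
  exists (- w); split; rewrite ?oppr_eq0 ?dotNr ?oppr_ge0 ?ltW//.
  by move=> v vs /(wT v vs); rewrite dotNr => ->; rewrite oppr0.
have [v1 v1s v1w] := cs w w0.
(* The step length at which [v] becomes tight; the smallest one keeps all constraints valid. *)
pose ratio v := (1 - dot (v - o) u) / dot (v - o) w.
have [|v0] := @seq_argmin R _ ratio v1 [seq v <- s | 0 < dot (v - o) w].
  by rewrite mem_filter v1w.
rewrite mem_filter => /andP[v0w v0s] v0min.
have r0 : 0 <= ratio v0 by rewrite divr_ge0 ?subr_ge0 ?u1// ltW.
pose u2 := u + ratio v0 *: w.
have u2E v : dot (v - o) u2 = dot (v - o) u + ratio v0 * dot (v - o) w.
  by rewrite dotDr dotZr.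
have [||u' fu' yu'] := IH u2.
- apply: (leq_trans _ (ltnSE le_n : (_ <= n)%N)).
  apply: (@count_lt _ _ _ _ v0) => //.
  + move=> v vs /=; apply: contra_neq => vu.
    by rewrite u2E vu (wT v vs vu) mulr0 addr0.
  + by apply/eqP => /(wT v0 v0s) h; rewrite h ltxx in v0w.
  + by rewrite negbK u2E divfK ?lt0r_neq0// addrC subrK.
- move=> v vs; rewrite u2E.
  have [vw|vw] := leP (dot (v - o) w) 0.
    by have := u1 v vs; have := mulr_ge0_le0 r0 vw; lra.
  have := v0min v; rewrite mem_filter vw vs => /(_ isT).
  by rewrite [X in _ <= X]/ratio ler_pdivlMr//; lra.
- exists u' => //; apply: le_trans yu'.
  by rewrite u2E lerDl mulr_ge0.
Qed.

(** A functional separating [x], scaled to be at most 1 on [s - o], improves by [ex_facet_normal] to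
    a facet normal that [x] still violates. *)
Lemma mem_conv_hull_facets s o x : s != [::] -> interior_center s o ->
  (forall u, facet_normal s o u -> dot (x - o) u <= 1) -> conv_hull [set` s] x.
Proof.
move=> s0 cs xf; apply: contrapT => /conv_hull_separation[w [a [sa ax]]].
have [v0 v0s] : exists v, v \in s.
  by case: s s0 {cs xf sa} => // v s _; exists v; rewrite mem_head.
have w0 : w != 0.
  apply: contraTneq ax => w0; rewrite -leNgt.
  by have := sa v0 v0s; rewrite w0 !(dotC _ 0) !dot0l.
have [v vs] := cs w w0; have := sa v vs; rewrite dotDl dotNl => va vo.
have g0 : 0 < a - dot o w by lra.
have [|u fu xu] := @ex_facet_normal s o x ((a - dot o w)^-1 *: w) cs.
  move=> v' v's; rewrite dotZr mulrC ler_pdivrMr// mul1r dotDl dotNl.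
  by rewrite lerB// sa.
have := le_trans xu (xf u fu).
rewrite dotZr mulrC ler_pdivrMr// mul1r dotDl dotNl; lra.
Qed.

(** A facet normal is determined by its tight subset of [s], since the tight vectors span; there are
    finitely many subsets. *)
Lemma facet_normals s o : exists2 fs : seq 'rV[R]_d,
  uniq fs & forall u, u \in fs <-> facet_normal s o u.
Proof.
pose T u : {set 'I_(size s)} := finset (fun i : 'I_(size s) => dot (nth 0 s i - o) u == 1).
have Tinj : {in [set u | facet_normal s o u] &, injective T}.
  move=> u u' /set_mem[_ fu] _ TT; apply/eqP; rewrite -subr_eq0; apply/eqP.
  apply: fu => v vs vu; pose i := Ordinal (etrans (index_mem v s) vs).
  have : i \in T u by rewrite inE /= nth_index// vu.
  rewrite TT inE /= nth_index// => /eqP vu'.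
  by rewrite dotDr dotNr vu vu' subrr.
have fin : finite_set [set u | facet_normal s o u].
  have /card_eqPle[_ h] := inj_card_eq Tinj.
  exact: card_le_finite h finite_finset.
have /finite_seqP[fs fsE] := fin.
exists (undup fs); first exact: undup_uniq.
move=> u; rewrite mem_undup; change (u \in fs <-> [set u | facet_normal s o u] u).
by rewrite fsE.
Qed.

(** If [w] is orthogonal to the normals tight at [p], the slack in the remaining inequalities keeps
    [p + e *: w] and [p - e *: w] in the hull for small [e], and extremality gives [w = 0]. *)
Lemma tight_normals_span s o (fs : seq 'rV[R]_d) p :
  s != [::] -> interior_center s o ->
  (forall u, u \in fs <-> facet_normal s o u) ->
  conv_hull [set` s] p -> extreme_point (conv_hull [set` s]) p ->
  forall w, (forall u, u \in fs -> dot (p - o) u = 1 -> dot w u = 0) -> w = 0.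
Proof.
move=> s0 cs fsP Kp xp w wT.
have pf u : u \in fs -> dot (p - o) u <= 1.
  move=> /fsP[us _]; rewrite dotDl dotNl lerBlDr.
  by apply: conv_hull_le Kp => v /us; rewrite dotDl dotNl lerBlDr.
have [|e e0 eP] := @fin_uniform_eps R 'I_(size fs) (fun i e =>
    dot (p - o) (nth 0 fs i) + e * `|dot w (nth 0 fs i)| <= 1).
  move=> i; have us : nth 0 fs i \in fs by rewrite mem_nth.
  set u := nth 0 fs i in us *.
  have [pu|pu] := eqVneq (dot (p - o) u) 1.
    by exists 1 => // e _; rewrite (wT u us pu) normr0 mulr0 addr0 pu.
  have D0 : 0 < `|dot w u| + 1 by rewrite ltr_wpDl.
  exists ((1 - dot (p - o) u) / (`|dot w u| + 1)).
    by rewrite divr_gt0// subr_gt0 lt_neqAle pu pf.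
  move=> e /andP[e0]; rewrite ler_pdivlMr//; lra.
have eK (t : R) : `|t| = e -> conv_hull [set` s] (p + t *: w).
  move=> te; apply: (mem_conv_hull_facets s0 cs) => u /fsP us.
  have := eP (Ordinal (etrans (index_mem u fs) us)); rewrite /= nth_index//.
  rewrite (addrAC p) (dotDl (p - o)) dotZl -te -normrM.
  by have := ler_norm (t * dot w u); lra.
have /eqP : e *: w = 0.
  apply: xp; first by apply: eK; rewrite gtr0_norm.
  by rewrite -scaleNr; apply: eK; rewrite normrN gtr0_norm.
by rewrite scaler_eq0 gt_eqF//= => /eqP.
Qed.

(* If [w] is orthogonal to the normals not tight at [p], then an essential point
   [x] near [p] cannot be covered at [x + w] by another translate: the facet
   separating [x + lat R z] from the body is not tight at [p], because
   [p + lat R z] lies in the body, so it separates [x + w + lat R z] too. *)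
Lemma nontight_normals_span s o (fs : seq 'rV[R]_d) p (K := conv_hull [set` s]) :
  s != [::] -> interior_center s o ->
  (forall u, u \in fs <-> facet_normal s o u) ->
  compact K -> covering K -> essential_limit K p -> extreme_point K p ->
  forall w, (forall u, u \in fs -> dot (p - o) u != 1 -> dot w u = 0) -> w = 0.
Proof.
move=> s0 cs fsP cK covK Up xp w wT.
have Kf x u : K x -> u \in fs -> dot (x - o) u <= 1.
  move=> Kx /fsP[us _]; rewrite dotDl dotNl lerBlDr.
  by apply: conv_hull_le Kx => v /us; rewrite dotDl dotNl lerBlDr.
have [e e0 eP] := essential_push cK covK Up.
have D0 : 0 < `|w| + 1 by rewrite ltr_wpDl.
pose t := e / (`|w| + 1).
have t0 : 0 < t by rewrite divr_gt0.
have tK (r : R) : `|r| = t -> K (p + r *: w).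
  move=> rt; apply: (eP 0) => //.
    by rewrite normrZ rt mulrAC ltr_pdivrMr// ltr_pM2l// ltrDl.
  move=> x z [Kx Ux] z0 Kpz; rewrite scale0r addr0 => Kyz.
  have /Ux/eqP : K (x + lat R z); last by rewrite (negbTE z0).
  apply: (mem_conv_hull_facets s0 cs) => u /fsP us.
  have [pu|pu] := eqVneq (dot (p - o) u) 1.
    have := Kf _ _ Kx us; have := Kf _ _ Kpz us.
    by move: pu; rewrite !dotL; lra.
  by have := Kf _ _ Kyz us; rewrite !dotL (wT u us pu) mulr0 addr0.
have /eqP : t *: w = 0.
  apply: xp; first by apply: tK; rewrite gtr0_norm.
  by rewrite -scaleNr; apply: tK; rewrite normrN gtr0_norm.
by rewrite scaler_eq0 gt_eqF//= => /eqP.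
Qed.

End Polytope.

(** * Farthest points generate the body; affine hulls and facets *)

Section Facets.
Variables (R : realType) (d : nat).
Implicit Types (K A : set 'rV[R]_d) (x y p u v w o : 'rV[R]_d).
Implicit Types s : seq 'rV[R]_d.

(* A point outside the hull of the farthest points is separated from them by a
   ball with a far away center, so a point of [K] farthest from that center
   cannot be one of them. *)
Lemma minimal_covering_conv_hull K : minimal_covering_body K ->
  exists s, K = conv_hull [set` s].
Proof.
move=> mK; have [[K0 cK cvK] _ _] := mK.
have /finite_seqP[s sE] := finite_farthest_points mK.
exists s; apply/seteqP; split; last first.
  apply: conv_hull_sub => //; rewrite -sE => p [c [Kp _]]; exact: Kp.
move=> y Ky; apply: contrapT => /conv_hull_separation[w [a [sa ay]]].
pose g := dot y w - a.
have g0 : 0 < g by rewrite subr_gt0.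
(* [M] bounds the squared distance from [y] to each point of [s], and [t * g > M] makes every one of
   them closer to the center [y - t *: w] than [y] is. *)
pose M := \sum_(v <- s) dot (v - y) (v - y).
pose t := M / g + 1.
have M0 : 0 <= M by apply: sumr_ge0 => v _; exact: dot_ge0.
have t0 : 0 < t by rewrite ltr_wpDl// divr_ge0// ltW.
have [p pf] := ex_farthest (y - t *: w) K0 cK.
have ps : p \in s.
  have : farthest_points K p by exists (y - t *: w).
  by rewrite sE.
have := pf.2 y Ky; have := sa p ps.
have -> : y - (y - t *: w) = t *: w by rewrite opprB addrC subrK.
have -> : p - (y - t *: w) = (p - y) + t *: w by rewrite opprB addrA addrAC.
have pM : dot (p - y) (p - y) <= M.
  by rewrite /M (big_rem p)//= lerDl sumr_ge0// => v _; exact: dot_ge0.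
have tM : M < t * g by rewrite /t mulrDl divfK ?lt0r_neq0// mul1r ltrDl.
have -> : dot p w = dot (p - y) w + dot y w by rewrite -dotDl subrK.
move: pM tM; rewrite /g; move: (p - y) => v.
rewrite !dotL (dotC w v); nra.
Qed.

(** The orthogonality condition puts [x - v0] in the span of the [v - v0], and an affine set through
    [v0] is closed under linear combinations based at [v0]. *)
Lemma affine_set_span A (s : seq 'rV[R]_d) v0 x : affine_set A -> A v0 ->
  (forall v, v \in s -> A v) ->
  (forall w, (forall v, v \in s -> dot (v - v0) w = 0) -> dot (x - v0) w = 0) ->
  A x.
Proof.
move=> affA Av0 sA xw.
have AZ t y : A (v0 + y) -> A (v0 + t *: y).
  move=> /(affA _ _ t Av0); congr A.
  by apply/rowP => i; rewrite !mxE; ring.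
have AD y z : A (v0 + y) -> A (v0 + z) -> A (v0 + (y + z)).
  move=> Ay Az; have /(AZ 2) : A (v0 + ((1 - 2^-1) *: y + 2^-1 *: z)).
    move: (affA _ _ 2^-1 Ay Az); congr A.
    by apply/rowP => i; rewrite !mxE; ring.
  by congr A; apply/rowP => i; rewrite !mxE; field.
pose B : 'M[R]_(size s, d) := \matrix_(i < size s) (nth 0 s i - v0).
have /submxP[D xD] : (x - v0 <= B)%MS.
  have dot_coker z j : dot z (col j (cokermx B))^T = (z *m cokermx B) 0 j.
    by rewrite dotE mxE; apply: eq_bigr => k _; rewrite !mxE.
  rewrite submxE; apply/eqP/rowP => j; rewrite -dot_coker [RHS]mxE.
  apply: xw => v vs; pose i := Ordinal (etrans (index_mem v s) vs).
  have <- : row i B = v - v0 by rewrite rowK /= nth_index.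
  by rewrite dot_coker -row_mul mulmx_coker !mxE.
rewrite -(subrK v0 x) addrC xD mulmx_sum_row.
elim/big_ind : _ => [|y z|i _]; first by rewrite addr0.
  exact: AD.
by apply: AZ; rewrite rowK addrC subrK; apply/sA/mem_nth.
Qed.

Lemma affine_dim_conv_hull s o v0 : v0 \in s -> interior_center s o ->
  has_affine_dim (conv_hull [set` s]) d.
Proof.
move=> v0s cs; exists 0, fullv; split; first by rewrite dimvf dim_matrix mul1r.
apply/seteqP; split=> [x _|x _].
  by exists x; rewrite ?add0r//= memvf.
move=> A [affA sA]; apply: (@affine_set_span A s v0 x affA).
- by apply: sA; exact: sub_conv_hull.
- by move=> v vs; apply: sA; exact: sub_conv_hull.
move=> w ws; suff -> : w = 0 by rewrite dotC dot0l.
have sw v : v \in s -> dot v w = dot v0 w.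
  by move=> /ws; rewrite dotDl dotNl => /eqP; rewrite subr_eq0 => /eqP.
apply/eqP; apply: contrapT => /negP w0.
have [v vs] := cs w w0.
have [|v' v's] := cs (- w) _; first by rewrite oppr_eq0.
rewrite !dotL (sw v vs) (sw v' v's) => h1 h2; suff : (0 : R) < 0 by rewrite ltxx.
lra.
Qed.

Definition facet_of s o u : set 'rV[R]_d :=
  conv_hull [set` s] `&` [set x | dot (x - o) u = 1].

Lemma facet_of_tight s o u v : v \in s -> dot (v - o) u = 1 -> facet_of s o u v.
Proof. by move=> vs vu; split=> //; exact: sub_conv_hull. Qed.

(** Points of [s] tight for [u] lie on the common facet, so they are tight for [u'] too; they span,
    whence [u - u' = 0]. *)
Lemma facet_of_inj s o u u' : facet_normal s o u ->
  facet_of s o u = facet_of s o u' -> u = u'.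
Proof.
move=> [_ fu] FF; apply/eqP; rewrite -subr_eq0; apply/eqP; apply: fu => v vs vu.
have : facet_of s o u v by exact: facet_of_tight.
by rewrite FF dotDr dotNr vu => -[_ /= ->]; rewrite subrr.
Qed.

End Facets.

(** * Dimension of facets, in ambient dimension [d.+1] *)

Section FacetDim.
Variables (R : realType) (d : nat).
Implicit Types (x y p u v w o : 'rV[R]_d.+1) (s : seq 'rV[R]_d.+1).

Lemma facet_normal_tight s o u : facet_normal s o u ->
  exists2 v, v \in s & dot (v - o) u = 1.
Proof.
move=> [_ fu]; apply: contrapT => nv.
(* Without tight points the spanning condition would make every vector zero, impossible in positive
   dimension. *)
have /rowP/(_ 0)/eqP : (const_mx 1 : 'rV[R]_d.+1) = 0.
  by apply: fu => v vs vu; case: nv; exists v.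
by rewrite !mxE oner_eq0.
Qed.

(** The affine hull is [v0] plus the kernel of [dot _ u], a functional that is nonzero since it
    takes the value 1 at [v0 - o]; rank-nullity gives dimension [d]. *)
Lemma affine_dim_facet_of s o u : facet_normal s o u ->
  has_affine_dim (facet_of s o u) d.
Proof.
move=> fu; have [v0 v0s v0u] := facet_normal_tight fu.
pose f : 'Hom('rV[R]_d.+1, 'M[R]_1) := linfun (mulmxr u^T).
have kf x : (x \in lker f) = (dot x u == 0).
  rewrite memv_ker lfunE /=; apply/eqP/eqP => [|xu].
    by rewrite /dot => ->; rewrite mxE.
  by apply/matrixP => i j; rewrite !ord1 [LHS]xu mxE.
exists v0, (lker f); split.
  have := limg_ker_dim f fullv; rewrite capfv dimvf dim_matrix mul1r.
  suff -> : \dim (f @: fullv) = 1%N by rewrite addn1 => -[].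
  apply/eqP; rewrite eqn_leq; apply/andP; split.
    by apply: leq_trans (dimvS (subvf _)) _; rewrite dimvf dim_matrix.
  rewrite lt0n dimv_eq0; apply/eqP => f0.
  have : f (v0 - o) \in (f @: fullv)%VS by rewrite memv_img// memvf.
  rewrite f0 memv0 lfunE /= => /eqP/matrixP/(_ 0 0).
  by rewrite -/(dot _ _) v0u mxE => /eqP; rewrite oner_eq0.
apply/seteqP; split.
  apply: smallest_sub => [x y t|].
    move=> [a /= a0 <-] [b /= b0 <-]; exists ((1 - t) *: a + t *: b).
      by rewrite /= memvD// memvZ.
    by apply/rowP => i; rewrite !mxE; ring.
  move=> x [_ /= xu]; exists (x - v0); last by rewrite addrC subrK.
  rewrite /= kf (_ : x - v0 = (x - o) - (v0 - o)).
    by rewrite dotDl dotNl xu v0u subrr.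
  by apply/rowP => i; rewrite !mxE; ring.
move=> _ [x /= + <-]; rewrite kf => /eqP xu A [affA FA].
pose T := [seq v <- s | dot (v - o) u == 1].
apply: (@affine_set_span _ _ A T v0 _ affA).
- exact/FA/facet_of_tight.
- by move=> v; rewrite mem_filter => /andP[/eqP vu vs]; exact/FA/facet_of_tight.
(* A [w] orthogonal to all differences of tight points is constant on the tight [v - o]; subtracting
   that constant times [u] gives zero, so [w] is a multiple of [u]. *)
move=> w wT; have /eqP : w - dot (v0 - o) w *: u = 0.
  apply: fu.2 => v vs vu; rewrite dotDr dotNr dotZr vu.
  have := wT v; rewrite mem_filter vu eqxx vs => /(_ isT).
  rewrite (_ : v - v0 = (v - o) - (v0 - o)); last first.
    by apply/rowP => i; rewrite !mxE; ring.
  by rewrite dotDl dotNl mulr1.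
rewrite subr_eq0 => /eqP ->.
by rewrite dotZr [v0 + x]addrC addrK xu mulr0.
Qed.

Lemma facet_facet_of s o u : interior_center s o -> facet_normal s o u ->
  facet (conv_hull [set` s]) (facet_of s o u).
Proof.
move=> cs fu; have [v0 v0s _] := facet_normal_tight fu; split; last first.
  exists d; first exact: affine_dim_conv_hull v0s cs.
  exact: affine_dim_facet_of.
exists u^T, (1 + dot o u); split=> [x sx|].
  rewrite -/(dot x u); apply: conv_hull_le sx => v /fu.1.
  by rewrite dotDl dotNl lerBlDr.
apply/seteqP; split=> x [sx] /=; rewrite -/(dot x u) ?dotDl ?dotNl => xu.
  by split=> //=; rewrite -xu subrK.
by split=> //=; rewrite dotDl dotNl xu addrK.
Qed.

End FacetDim.

Theorem theorem1p1 (R : realType) (d : nat) (K : set 'rV[R]_d)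
    (hd : (1 <= d)%N) (hK : minimal_covering_body K) :
  polytope K /\ `I_(2 * d) #<= [set F : set 'rV[R]_d | facet K F].
Proof.
case: d hd K hK => // d _ K mK; have [s Ks] := minimal_covering_conv_hull mK.
split; first by exists [set` s] => //; exact: finite_seq.
have [[K0 cK _] covK _] := mK.
(* A single farthest point suffices, so the center is arbitrary. *)
have [p pf] := ex_farthest 0 K0 cK.
have xp := farthest_extreme pf; have Up := farthest_essential mK pf.
have Kp := pf.1; subst K.
have s0 : s != [::].
  apply/eqP => s0; rewrite s0 in Kp.
  by have := @conv_hull_sub R d.+1 _ set0 _ _ p Kp; apply.
have [c cs] := ex_interior_center K0 covK.
have [fs uniq_fs fsP] := facet_normals s c.
pose tight u := dot (p - c) u == 1.
have size1 : (d.+1 <= size [seq u <- fs | tight u])%N.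
  apply: orthogonal_size => w wT.
  apply: (tight_normals_span s0 cs fsP Kp xp) => u us pu.
  by apply: wT; rewrite mem_filter us /tight pu eqxx.
have size2 : (d.+1 <= size [seq u <- fs | ~~ tight u])%N.
  apply: orthogonal_size => w wT.
  apply: (nontight_normals_span s0 cs fsP cK covK Up xp) => u us pu.
  by apply: wT; rewrite mem_filter us andbT.
have size_fs : (2 * d.+1 <= size fs)%N.
  rewrite -(count_predC tight fs) -!size_filter mul2n -addnn.
  exact: leq_add size1 size2.
pose F i := facet_of s c (nth 0 fs i).
have Finj : {in `I_(2 * d.+1) &, injective F}.
  move=> i j /set_mem /= ilt /set_mem /= jlt FF.
  have isz := leq_trans ilt size_fs; have jsz := leq_trans jlt size_fs.
  apply/eqP; rewrite -(nth_uniq 0 isz jsz uniq_fs); apply/eqP.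
  by apply: facet_of_inj FF; apply/fsP/mem_nth.
have /card_eqPle[_ h] := inj_card_eq Finj.
apply: card_le_trans h _; apply: subset_card_le => _ [i /= ilt <-].
by apply: facet_facet_of => //; apply/fsP/mem_nth/(leq_trans ilt).
Qed.
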